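(* Let $\alpha>0$, $\theta\in\mathbb{R}$ and $-\infty<\beta<1$, and let $\Gamma_{\alpha,\theta}=\{n^\alpha e^{2\pi n\theta\sqrt{-1}} \mid n\in\mathbb{Z}_{\ge 0}\}\subset\mathbb{C}$. Suppose that $1+2\alpha\beta=2\alpha$. Then the following statements are mutually equivalent: (i) $\Gamma_{\alpha,\theta}$ is asymptotically $\beta$-relatively dense. (ii) $\Gamma_{\alpha,\theta}$ is asymptotically $\beta$-uniformly discrete. (iii) $\theta$ is badly approximable.
   Context: A real number $\theta$ is called badly approximable if it is irrational and the set of partial quotients $\{a_i\mid i\ge 0\}$ of its continued fraction expansion $\theta=[a_0,a_1,a_2,\dots]$ ($a_0\in\mathbb{Z}$, $a_i\in\mathbb{Z}_{>0}$ for $i\ge 1$) is bounded. For a point set $\Gamma\subset\mathbb{C}$ put $\Gamma'=\{\gamma\in\Gamma \mid |\gamma|\ge 1\}$. Let $-\infty<\beta<1$. $\Gamma$ is called asymptotically $\beta$-relatively dense if there exists $r>0$ satisfying one (equivalently, all) of the following three conditions, which are mutually equivalent for each fixed $r$: (i) for any $r_1>r$ there exists $M_1>0$ such that for any $z\in\mathbb{C}$ with $|z|\ge M_1$ there exists $\zeta\in\Gamma'$ with $|z-\zeta|<r_1|z|^\beta$; (ii) for any $r_2>r$ there exists $M_2>0$ such that for any $z\in\mathbb{C}$ with $|z|\ge M_2$ there exists $\zeta\in\Gamma'$ with $|z-\zeta|<r_2|\zeta|^\beta$; (iii) for any $r_3>r$ there exists $M_3>0$ such that for any $z\in\mathbb{C}$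 with $|z|\ge M_3$ there exists $\zeta\in\Gamma'$ with $|z-\zeta|<\frac{r_3}{2}(|z|^\beta+|\zeta|^\beta)$. A locally finite set $\Gamma$ (i.e. $\#\{\zeta\in\Gamma \mid |\zeta|<r\}<\infty$ for every $r>0$) is called asymptotically $\beta$-uniformly discrete if there exists $s>0$ satisfying one (equivalently, all) of the following three conditions, which are mutually equivalent for each fixed $s$: (i) for any $0<s_1<s$ there exists $M_1>0$ such that for any $z\in\mathbb{C}$ with $|z|\ge M_1$, $\#\{\zeta\in\Gamma' \mid |z-\zeta|<s_1|z|^\beta\}\le 1$; (ii) for any $0<s_2<s$ there exists $M_2>0$ such that for any $z\in\mathbb{C}$ with $|z|\ge M_2$, $\#\{\zeta\in\Gamma' \mid |z-\zeta|<s_2|\zeta|^\beta\}\le 1$; (iii) for any $0<s_3<s$ there exists $M_3>0$ such that for any $z\in\mathbb{C}$ with $|z|\ge M_3$, $\#\{\zeta\in\Gamma' \mid |z-\zeta|<\frac{s_3}{2}(|z|^\beta+|\zeta|^\beta)\}\le 1$. *)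

(* Defs.v *)
From mathcomp Require Export all_boot all_order all_algebra.
From mathcomp Require Export all_classical all_reals all_analysis.
From mathcomp Require Export complex.

Set Implicit Arguments.
Unset Strict Implicit.
Unset Printing Implicit Defensive.

Import Order.TTheory GRing.Theory Num.Theory.

Local Open Scope card_scope.
Local Open Scope classical_set_scope.
Local Open Scope ring_scope.
Local Open Scope complex_scope.

(* The modulus of a complex number as an element of R; the generic norm `|z|
   on R[i] takes its values in R[i]. *)
Notation cabs := ComplexField.Normc.normc.

(* theta = [a_0, ..., a_(n-1), x_n] with x_n the n-th complete quotient; the
   recursion is meaningful for irrational theta, where x_n is never an
   integer. *)
Fixpoint complete_quotient (R : realType) (theta : R) (n : nat) : R :=
  if n is m.+1 then
    let x := complete_quotient theta m in (x - (Num.floor x)%:~R)^-1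
  else theta.

Definition partial_quotient (R : realType) (theta : R) (n : nat) : int :=
  Num.floor (complete_quotient theta n).

Definition badly_approximable (R : realType) (theta : R) : Prop :=
  irrational theta /\
  exists B : int, forall i : nat, `|partial_quotient theta i| <= B.

Definition outside_unit_disc (R : realType) (G : set R[i]) : set R[i] :=
  [set zeta | G zeta /\ 1 <= cabs zeta].

(* In this definition and in asymp_uniformly_discrete below, the scale
   |z|^beta may equivalently (for beta < 1, with the same r or s) be replaced
   by |zeta|^beta or by the mean of the two. *)
Definition asymp_relatively_dense (R : realType) (beta : R) (G : set R[i])
    : Prop :=
  exists2 r : R, 0 < r &
    forall r1 : R, r < r1 ->
    exists2 M1 : R, 0 < M1 &
      forall z : R[i], M1 <= cabs z ->
      exists2 zeta : R[i], outside_unit_disc G zeta &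
        cabs (z - zeta) < r1 * cabs z `^ beta.

Definition locally_finite_set (R : realType) (G : set R[i]) : Prop :=
  forall r : R, 0 < r -> finite_set [set zeta | G zeta /\ cabs zeta < r].

Definition asymp_uniformly_discrete (R : realType) (beta : R) (G : set R[i])
    : Prop :=
  locally_finite_set G /\
  exists2 s : R, 0 < s &
    forall s1 : R, 0 < s1 -> s1 < s ->
    exists2 M1 : R, 0 < M1 &
      forall z : R[i], M1 <= cabs z ->
      [set zeta | outside_unit_disc G zeta /\
                  cabs (z - zeta) < s1 * cabs z `^ beta] #<= `I_1.

Definition expi (R : realType) (t : R) : R[i] := cos t +i* sin t.

(* For alpha > 0 the term n = 0 is the origin, since 0 `^ alpha = 0. *)
Definition spiral_set (R : realType) (alpha theta : R) : set R[i] :=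
  range (fun n : nat =>
    (n%:R `^ alpha)%:C * expi (2 * pi * n%:R * theta)).

(* Main.v *)
Require Import Defs.
From mathcomp Require Import ring lra zify.
Import Order.TTheory GRing.Theory Num.Theory.
Import numFieldNormedType.Exports.
Local Open Scope ring_scope.

(** Write a point of modulus [x `^ alpha] as [x `^ alpha * exp(2 pi i t)], so that
    the [n]-th point of the spiral has index [n] and phase [n * theta].  The
    hypothesis on [alpha] and [beta] says that the scale [|z| `^ beta] is
    [x `^ alpha / sqrt x].  Hence two points near radius [x `^ alpha] are within a
    bounded multiple of the scale exactly when their indices differ by
    [O(sqrt x)] and their phases by [O(1 / sqrt x)] modulo [1]
    ([polar_close_coords], [coords_close_polar]).  Both geometric properties thus
    become statements on the numbers [n * theta] modulo [1], with [n] in a window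
    of width of order [sqrt x], at resolution [1 / sqrt x]: uniform discreteness
    says that they repel each other, relative density that they leave no hole.

    Both are compared with the condition [diophantine]: [m * `|m * theta - p|]
    is bounded away from [0].  If it fails for some [m], then the points of
    indices [N] and [N + m] are too close to each other, and the phases in a
    window of length a large multiple of [m] cluster around [m] equidistant
    values and miss the midpoint between two of them
    ([uniformly_discrete_diophantine], [relatively_dense_diophantine]).
    Conversely, [diophantine] separates the points directly
    ([diophantine_uniformly_discrete]).  For relative density one takes, at each
    [Q] of order [sqrt x], a reduced fraction [p / q] with
    [`|q * theta - p| <= 1 / q] and [q] between [Q] and a bounded multiple of [Q]:
    along [q] consecutive indices the phases follow all the multiples of [1 / q]
    ([scale_relatively_dense]).

    Such fractions are convergents of the continued fraction of [theta]; they
    exist at every scale when the partial quotients are bounded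
    ([badly_approximable_scale]) and imply [diophantine] ([scale_diophantine]).
    Conversely, a large partial quotient makes the preceding convergent violate
    [diophantine] ([diophantine_badly_approximable]), which closes the circle. *)

Set Implicit Arguments.
Unset Strict Implicit.

(** * Distances in polar coordinates *)

Section Geometry.
Local Open Scope complex_scope.
Context {R : realType}.
Implicit Types (r s t u x y : R) (z w : R[i]).

Lemma sin_eq_cosM u : 0 <= u -> exists2 v, 0 <= v <= u & sin u = cos v * u.
Proof.
move=> u0; have [|v] := @MVT_segment R sin cos 0 u u0.
  exact/continuous_subspaceT/continuous_sin.
by rewrite in_itv/= sin0 !subr0 => vu ->; exists v.
Qed.

Lemma normr_sin_le u : `|sin u| <= `|u|.
Proof.
wlog u0 : u / 0 <= u => [hw|].
  have [/hw//|/ltW u0] := leP 0 u.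
  by have := hw (- u); rewrite sinN !normrN oppr_ge0 => /(_ u0).
have [v _ ->] := sin_eq_cosM u0.
by rewrite normrM ler_piMl// cos_max.
Qed.

(** A weak form of Jordan's inequality, which suffices because only the order
    of magnitude of chords matters.  Halving the angle keeps the cosine away
    from [0]: [sin u = 2 * sin (u / 2) * cos (u / 2)], and both this cosine and
    the one given by the mean value theorem are at least [cos (pi / 4)]. *)
Lemma normr_sin_ge u : `|u| <= pi / 2 -> `|u| / 2 <= `|sin u|.
Proof.
wlog u0 : u / 0 <= u => [hw|].
  have [/hw h /h//|/ltW u0] := leP 0 u.
  by have := hw (- u); rewrite sinN !normrN oppr_ge0 => /(_ u0).
rewrite (ger0_norm u0) => upi.
have pi0 := pi_gt0 R.
have qpi : 2 * cos (pi / 4) ^+ 2 = 1 :> R.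
  have := cos_mulr2n (pi / 4 : R).
  rewrite (_ : pi / 4 *+ 2 = pi / 2); last by rewrite mulr2n; field.
  by rewrite cos_pihalf => /eqP; rewrite eq_sym subr_eq0 mulr_natl => /eqP.
have cq0 : 0 <= cos (pi / 4 : R) by apply: cos_ge0_pihalf; lra.
have cosge v : 0 <= v <= u / 2 -> cos (pi / 4) <= cos v.
  move=> /andP[v0 vu]; rewrite leNgt ltr_cos ?in_itv/=; last 2 first.
  - by lra.
  - by lra.
  by rewrite -leNgt; lra.
have [|v vu sE] := @sin_eq_cosM (u / 2); first by lra.
have sinE : sin u = u * (cos (u / 2) * cos v).
  have uE : u = (u / 2) *+ 2 by rewrite mulr2n; field.
  by rewrite [in LHS]uE sin_mulr2n sE mulr2n; field.
have cu : cos (pi / 4) <= cos (u / 2) by apply: cosge; lra.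
have cv := cosge v vu.
have : cos (pi / 4) ^+ 2 <= cos (u / 2) * cos v :> R by rewrite expr2 ler_pM.
rewrite (_ : cos (pi / 4) ^+ 2 = 1 / 2); last by lra.
move=> /(ler_wpM2l u0) h.
by rewrite ger0_norm sinE ?mulr_ge0 ?(le_trans cq0 cu) ?(le_trans cq0 cv)//; lra.
Qed.

Definition polar r t : R[i] := r%:C * expi t.

Lemma polarE r t : polar r t = (r * cos t) +i* (r * sin t).
Proof. by rewrite /polar /expi; simpc. Qed.

Lemma cabsE (a b : R) : cabs (a +i* b) = Num.sqrt (a ^+ 2 + b ^+ 2).
Proof. by []. Qed.

Lemma cabs_ge0 z : 0 <= cabs z.
Proof. by case: z => a b; exact: sqrtr_ge0. Qed.

Lemma ler_cabsD z w : cabs (z + w) <= cabs z + cabs w.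
Proof. exact: le_normcD. Qed.

Lemma cabs_polar r t : 0 <= r -> cabs (polar r t) = r.
Proof.
move=> r0; rewrite polarE cabsE.
rewrite !exprMn -mulrDr cos2Dsin2 mulr1 sqrtr_sqr ger0_norm//.
Qed.

Lemma polarP z : exists t, z = polar (cabs z) t.
Proof.
case: z => a b.
have [r0|r0] := eqVneq (cabs (a +i* b)) 0.
  by exists 0; rewrite r0 polarE !mul0r; apply: ComplexField.Normc.eq0_normc.
have rp : 0 < cabs (a +i* b) by rewrite lt_def r0 cabs_ge0.
set r := cabs _ in r0 rp *.
have r2 : r ^+ 2 = a ^+ 2 + b ^+ 2.
  by rewrite /r cabsE sqr_sqrtr// addr_ge0 ?sqr_ge0.
have ar : -1 <= a / r <= 1.
  have : `|a| ^+ 2 <= r ^+ 2 by rewrite r2 real_normK ?num_real// lerDl sqr_ge0.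
  rewrite ler_pXn2r ?nnegrE ?(ltW rp)// => ar.
  by rewrite -ler_norml normrM normfV (gtr0_norm rp) ler_pdivrMr// mul1r.
have ca : r * cos (acos (a / r)) = a.
  by rewrite acosK ?in_itv//= mulrC divfK.
have sa : r * sin (acos (a / r)) = `|b|.
  rewrite sin_acos//.
  have -> : 1 - (a / r) ^+ 2 = (b / r) ^+ 2.
    have b2 : b ^+ 2 = r ^+ 2 - a ^+ 2 by rewrite r2; ring.
    by rewrite [RHS]exprMn b2; field.
  by rewrite sqrtr_sqr normrM normfV (gtr0_norm rp) mulrC divfK.
have [b0|b0] := leP 0 b.
  by exists (acos (a / r)); rewrite polarE ca sa ger0_norm.
exists (- acos (a / r)).
by rewrite polarE cosN sinN ca mulrN sa ltr0_norm// opprK.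
Qed.

(** The law of cosines with [1 - cos] written as a squared sine: a sum of a
    radial and an angular contribution, both nonnegative for [r, s >= 0], so
    that each of them is bounded by the distance. *)
Lemma cabs_polarB r s t u :
  cabs (polar r t - polar s u) ^+ 2
  = (r - s) ^+ 2 + 4 * r * s * sin ((t - u) / 2) ^+ 2.
Proof.
rewrite !polarE.
have -> : (r * cos t +i* (r * sin t)) - (s * cos u +i* (s * sin u))
   = (r * cos t - s * cos u) +i* (r * sin t - s * sin u) by simpc.
rewrite cabsE sqr_sqrtr ?addr_ge0 ?sqr_ge0//.
have h : cos (t - u) = 1 - 2 * sin ((t - u) / 2) ^+ 2.
  have := cos_mulr2n ((t - u) / 2).
  rewrite (_ : (t - u) / 2 *+ 2 = t - u); last by rewrite mulr2n; field.
  by move=> ->; rewrite cos2sin2 mulr2n; ring.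
have -> : 4 * r * s * sin ((t - u) / 2) ^+ 2
   = 2 * r * s * (1 - cos (t - u)) by rewrite h; ring.
rewrite cosB.
have := cos2Dsin2 t; have := cos2Dsin2 u.
set ct := cos t; set st := sin t; set cu := cos u; set su := sin u.
move=> hu ht.
have -> : (r * ct - s * cu) ^+ 2 + (r * st - s * su) ^+ 2
  = r ^+ 2 * (ct ^+ 2 + st ^+ 2) + s ^+ 2 * (cu ^+ 2 + su ^+ 2)
    - 2 * r * s * (ct * cu + st * su) by ring.
by rewrite hu ht; ring.
Qed.

Lemma expiDint t (k : int) : expi (t + 2 * pi * k%:~R) = expi t.
Proof.
have nat_case (n : nat) v : expi (v + 2 * pi * n%:R) = expi v :> R[i].
  rewrite /expi.
  have -> : v + 2 * pi * n%:R = v + (pi *+ 2) *+ n.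
    by rewrite -[(pi *+ 2) *+ n]mulr_natr -[pi *+ 2]mulr_natl.
  by rewrite (periodicn (@cosD2pi R)) (periodicn (@sinD2pi R)).
case: k => n; first exact: nat_case.
rewrite -(nat_case n.+1 (t + _)) NegzE; congr expi.
by rewrite mulrNz; rewrite -/(n.+1%:R) pmulrn; ring.
Qed.

(** Angles are measured in turns, so that phases are compared modulo integers.
    The path from one point to the other goes first along a ray, then along
    the circle of radius [s]. *)
Lemma cabs_polarB_le r s x y (k : int) : 0 <= r -> 0 <= s ->
  cabs (polar r (2 * pi * x) - polar s (2 * pi * y))
  <= `|r - s| + s * (2 * pi * `|x - y - k%:~R|).
Proof.
move=> r0 s0.
have -> : polar r (2 * pi * x) - polar s (2 * pi * y)
  = (polar r (2 * pi * x) - polar s (2 * pi * x))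
    + (polar s (2 * pi * x) - polar s (2 * pi * (y + k%:~R))).
  have -> : polar s (2 * pi * (y + k%:~R)) = polar s (2 * pi * y).
    by rewrite /polar mulrDr expiDint.
  by ring.
have pi0 := pi_gt0 R.
apply: le_trans (ler_cabsD _ _) _; apply: lerD.
  rewrite -(ler_pXn2r (n := 2))// ?nnegrE ?cabs_ge0//.
  by rewrite cabs_polarB subrr mul0r sin0 expr0n/= mulr0 addr0 real_normK ?num_real.
rewrite -(ler_pXn2r (n := 2))// ?nnegrE//; last first.
  by rewrite mulr_ge0// mulr_ge0//; lra.
  exact: cabs_ge0.
rewrite cabs_polarB subrr expr0n/= add0r.
have -> : (2 * pi * x - 2 * pi * (y + k%:~R)) / 2 = pi * (x - y - k%:~R) by field.
set d := x - y - k%:~R.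
have := normr_sin_le (pi * d); rewrite normrM (gtr0_norm pi0) => h.
have -> : (s * (2 * pi * `|d|)) ^+ 2 = 4 * s * s * (pi * `|d|) ^+ 2 by ring.
apply: ler_wpM2l; first by rewrite !mulr_ge0.
by rewrite -[leLHS]real_normK ?num_real// lerXn2r ?nnegrE// mulr_ge0// ltW.
Qed.

(** The integer is the one nearest to [x - y], which brings the half-angle into
    the range where the sine is bounded below linearly. *)
Lemma cabs_polarB_ge r s x y : 0 <= r -> 0 <= s ->
  exists k : int, Num.min r s * `|x - y - k%:~R|
    <= cabs (polar r (2 * pi * x) - polar s (2 * pi * y)).
Proof.
move=> r0 s0; set k : int := Num.floor (x - y + 2^-1); exists k.
have pi0 := pi_gt0 R; have pi2 := pi_ge2 R.
have /andP[k1 k2] := floor_itv (x - y + 2^-1).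
rewrite -/k in k1 k2; rewrite intrD in k2.
set d := x - y - k%:~R.
have dle : `|d| <= 1 / 2 by rewrite ler_norml /d; lra.
rewrite -(ler_pXn2r (n := 2))// ?nnegrE//; last 2 first.
- by rewrite mulr_ge0// le_min r0.
- exact: cabs_ge0.
have -> : polar s (2 * pi * y) = polar s (2 * pi * (y + k%:~R)).
  by rewrite /polar [in RHS]mulrDr expiDint.
rewrite cabs_polarB.
have -> : (2 * pi * x - 2 * pi * (y + k%:~R)) / 2 = pi * d by rewrite /d; field.
have := @normr_sin_ge (pi * d); rewrite normrM (gtr0_norm pi0) => h.
have {}h : pi * `|d| / 2 <= `|sin (pi * d)| by apply: h; nra.
rewrite -[sin _ ^+ 2]real_normK ?num_real//.
set S := `|sin _| in h *.
have S2 : `|d| <= S by apply: le_trans h; have := normr_ge0 d; nra.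
have m2 : Num.min r s ^+ 2 <= r * s.
  by rewrite expr2 ler_pM// ?le_min ?r0// ge_min lexx ?orbT.
rewrite exprMn.
apply: (@le_trans _ _ (r * s * S ^+ 2)).
  by apply: ler_pM => //; rewrite ?sqr_ge0// lerXn2r ?nnegrE ?(le_trans _ S2).
have := mulr_ge0 (mulr_ge0 r0 s0) (sqr_ge0 S).
have := sqr_ge0 (r - s); nra.
Qed.

End Geometry.

(** * Index and phase at the scale of the spiral *)

Section Scale.
Context {R : realType}.
Implicit Types (alpha beta a b s t u x y : R).

(** The relation between [alpha] and [beta] says that [alpha * beta] is
    [alpha - 1 / 2]: at radius [x `^ alpha], a distance comparable to the scale
    is a relative displacement of order [1 / sqrt x]. *)
Lemma powR_scale alpha beta x : 1 + 2 * alpha * beta = 2 * alpha -> 0 < x ->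
  (x `^ alpha) `^ beta = x `^ alpha / Num.sqrt x.
Proof.
move=> hab x0; rewrite -powRrM (_ : alpha * beta = alpha - 2^-1); last by lra.
by rewrite powRB ?(gt_eqF x0) ?implybT// powR12_sqrt ?ltW.
Qed.

(** From [1 + y <= expR y] and [expR v - 1 <= v * expR v]. *)
Lemma powR_incr_le alpha a b y :
  0 < alpha -> 0 < a -> a <= b -> b - a <= y * a ->
  b `^ alpha - a `^ alpha <= a `^ alpha * (alpha * y * expR (alpha * y)).
Proof.
move=> al0 a0 ab hy.
have y0 : 0 <= y by rewrite -(pmulr_lge0 _ a0) (le_trans _ hy)// subr_ge0.
have y1 : 0 <= 1 + y by rewrite addr_ge0.
have bE : b <= a * (1 + y) by lra.
have h1 : b `^ alpha <= a `^ alpha * expR (alpha * y).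
  apply: (@le_trans _ _ ((a * (1 + y)) `^ alpha)).
    by rewrite ge0_ler_powR ?nnegrE ?mulr_ge0 ?(ltW al0)//; lra.
  rewrite powRM ?(ltW a0)// ler_wpM2l ?powR_ge0//.
  by rewrite mulrC expRM ge0_ler_powR ?nnegrE ?expR_ge0 ?expR_ge1Dx ?(ltW al0).
have h2 : expR (alpha * y) - 1 <= alpha * y * expR (alpha * y).
  have := expR_ge1Dx (- (alpha * y)).
  rewrite -(ler_pM2r (expR_gt0 (alpha * y))) -expRD addNr expR0; lra.
have := ler_wpM2l (powR_ge0 a alpha) h2; lra.
Qed.

(** Points of comparable moduli, within a factor [3], have indices within a
    factor [3 `^ alpha^-1]; the division by [alpha] comes from the logarithmic
    derivative of [x `^ alpha]. *)
Definition gap_const alpha : R := 3 `^ alpha^-1 / alpha.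

Lemma gap_const_gt0 alpha : 0 < alpha -> 0 < gap_const alpha.
Proof. by move=> al0; rewrite divr_gt0// powR_gt0. Qed.

(** The converse of [powR_incr_le], from the lower bounds [1 - a / b] for
    [ln (b / a)] and [1 + v] for [expR v]. *)
Lemma powR_gap alpha a b : 0 < alpha -> 0 < a -> a <= b ->
  b `^ alpha <= 3 * a `^ alpha ->
  (b - a) * a `^ alpha <= gap_const alpha * a * (b `^ alpha - a `^ alpha).
Proof.
move=> al0 a0 ab b3.
have b0 : 0 < b by apply: lt_le_trans ab.
set c := 3 `^ alpha^-1.
have c0 : 0 <= c by exact: powR_ge0.
have cE : c `^ alpha = 3 by rewrite -powRrM mulVf ?gt_eqF// powRr1.
have bc : b <= c * a.
  rewrite leNgt; apply/negP => cab.
  have : (c * a) `^ alpha < b `^ alpha.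
    by rewrite gt0_ltr_powR ?nnegrE ?mulr_ge0// ltW.
  by rewrite powRM ?(ltW a0)// cE ltNge b3.
have ln_ge : 1 - a / b <= ln (b / a).
  have := @le_ln1Dx R (a / b - 1).
  rewrite ltrBrDr addNr divr_gt0// addrC subrK => /(_ isT).
  by rewrite -[b / a]invf_div lnV ?posrE ?divr_gt0//; lra.
have pw_ge : 1 + alpha * (1 - a / b) <= (b / a) `^ alpha.
  rewrite -[b / a in leRHS]lnK ?posrE ?divr_gt0// -expRM.
  apply: le_trans (expR_ge1Dx _).
  by rewrite lerD2l [leLHS]mulrC ler_wpM2r ?(ltW al0).
have abE : (b / a) `^ alpha * a `^ alpha = b `^ alpha.
  by rewrite -powRM ?divr_ge0 ?(ltW a0) ?(ltW b0)// divfK ?gt_eqF.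
have h1 : alpha * (1 - a / b) * a `^ alpha <= b `^ alpha - a `^ alpha.
  by have := ler_wpM2r (powR_ge0 a alpha) pw_ge; rewrite abE; lra.
have h2 : (b - a) * a `^ alpha
    = b / alpha * (alpha * (1 - a / b) * a `^ alpha).
  by field; rewrite !gt_eqF.
rewrite h2; apply: (@le_trans _ _ (b / alpha * (b `^ alpha - a `^ alpha))).
  by apply: ler_wpM2l h1; apply: divr_ge0; apply: ltW.
rewrite ler_wpM2r//.
  by rewrite subr_ge0 ge0_ler_powR ?nnegrE ?(ltW al0) ?(ltW a0) ?(ltW b0).
by rewrite /gap_const -/c mulrAC ler_wpM2r// invr_ge0 ltW.
Qed.

(** The bound on [d] makes the two powers comparable, so that the roles of [a]
    and [x] can be exchanged at the cost of a factor [2]. *)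
Lemma near_powR_gap alpha a x d : 0 < alpha -> 0 < a -> 0 < x ->
  `|x `^ alpha - a `^ alpha| <= d -> d <= x `^ alpha / 2 ->
  `|a - x| * x `^ alpha <= 2 * gap_const alpha * x * d.
Proof.
move=> al0 a0 x0; rewrite ler_norml => /andP[d1 d2] dx.
have K0 := gap_const_gt0 al0.
have [ax|xa] := leP a x.
- rewrite distrC ger0_norm ?subr_ge0//.
  have h := powR_gap al0 a0 ax.
  have {}h : (x - a) * a `^ alpha
      <= gap_const alpha * a * (x `^ alpha - a `^ alpha).
    by apply: h; lra.
  have h1 : gap_const alpha * a * (x `^ alpha - a `^ alpha)
      <= gap_const alpha * x * d.
    apply: ler_pM => //.
    - by rewrite mulr_ge0// ltW.
    - by rewrite subr_ge0 ge0_ler_powR ?nnegrE ?(ltW al0) ?(ltW a0) ?(ltW x0).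
    - by rewrite ler_wpM2l// ltW.
  have xa0 : 0 <= x - a by rewrite subr_ge0.
  have := @ler_wpM2l _ _ xa0 (x `^ alpha) (2 * a `^ alpha); lra.
- rewrite ger0_norm ?subr_ge0 ?(ltW xa)//.
  have h := powR_gap al0 x0 (ltW xa).
  have {}h : (a - x) * x `^ alpha
      <= gap_const alpha * x * (a `^ alpha - x `^ alpha).
    by apply: h; have := powR_ge0 x alpha; lra.
  have kx : 0 <= gap_const alpha * x by rewrite mulr_ge0// ltW.
  have := @ler_wpM2l _ _ kx (a `^ alpha - x `^ alpha) d.
  have := mulr_ge0 kx (le_trans (normr_ge0 (x `^ alpha - a `^ alpha)) _ : 0 <= d).
  rewrite ler_norml d1 d2 => /(_ isT); lra.
Qed.

(** Near radius [x `^ alpha], a distance of order the scale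
    [x `^ alpha / Num.sqrt x] forces the index to move by [O(sqrt x)] and the
    phase by [O(1 / sqrt x)] modulo [1].  With [coords_close_polar], it says that
    index divided by [sqrt x] and phase multiplied by [sqrt x] are coordinates
    in which the metric, in units of the scale, is Euclidean up to constants. *)
Lemma polar_close_coords alpha a x s t u : 0 < alpha -> 0 < a -> 0 < x ->
  s <= Num.sqrt x / 2 ->
  cabs (polar (x `^ alpha) (2 * pi * t) - polar (a `^ alpha) (2 * pi * u))
    <= s * (x `^ alpha / Num.sqrt x) ->
  `|a - x| <= 2 * gap_const alpha * s * Num.sqrt x /\
  exists k : int, `|t - u - k%:~R| <= 2 * s / Num.sqrt x.
Proof.
move=> al0 a0 x0 sx hz.
have X0 : 0 < x `^ alpha by rewrite powR_gt0.
have A0 : 0 < a `^ alpha by rewrite powR_gt0.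
have q0 : 0 < Num.sqrt x by rewrite sqrtr_gt0.
have qx : Num.sqrt x ^+ 2 = x by rewrite sqr_sqrtr// ltW.
set X := x `^ alpha in hz X0 *; set A := a `^ alpha in hz A0 *.
set q := Num.sqrt x in sx hz q0 qx *.
have hd : s * (X / q) <= X / 2.
  have -> : s * (X / q) = s / q * X by field; rewrite gt_eqF.
  have -> : X / 2 = q / 2 / q * X by field; rewrite gt_eqF.
  by rewrite ler_pM2r// ler_pM2r// invr_gt0.
have hr : `|X - A| <= s * (X / q).
  apply: le_trans hz; rewrite -(ler_pXn2r (n := 2))// ?nnegrE ?cabs_ge0//.
  rewrite cabs_polarB real_normK ?num_real// lerDl.
  by rewrite mulr_ge0 ?sqr_ge0// !mulr_ge0 ?ltW.
split.
  have := near_powR_gap al0 a0 x0 hr hd; rewrite -/X -qx.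
  have -> : 2 * gap_const alpha * q ^+ 2 * (s * (X / q))
      = 2 * gap_const alpha * s * q * X by field; rewrite gt_eqF.
  by rewrite ler_pM2r.
have [k hk] := cabs_polarB_ge t u (ltW X0) (ltW A0).
exists k; have {}hk := le_trans hk hz.
have : X / 2 <= Num.min X A.
  by rewrite le_min; move: hr; rewrite ler_norml => /andP[h1 h2]; lra.
move=> /(ler_wpM2r (normr_ge0 (t - u - k%:~R))) /le_trans /(_ hk).
have -> : X / 2 * `|t - u - k%:~R| = `|t - u - k%:~R| * (X / 2) by ring.
rewrite -ler_pdivlMr ?divr_gt0//.
by rewrite (_ : s * (X / q) / (X / 2) = 2 * s / q)//; field; rewrite !gt_eqF.
Qed.

(** The distance, in units of the scale, produced by an index displacement [A]
    and a phase displacement [B] in the rescaled coordinates. *)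
Definition spread_const alpha A B : R :=
  alpha * A * expR (alpha * A) + 2 * pi * B.

(** The hypothesis [1 <= x] makes the constant independent of [x]. *)
Lemma coords_close_polar alpha a x A B t u (k : int) :
  0 < alpha -> 1 <= x -> x <= a ->
  a - x <= A * Num.sqrt x -> `|t - u - k%:~R| <= B / Num.sqrt x ->
  cabs (polar (x `^ alpha) (2 * pi * t) - polar (a `^ alpha) (2 * pi * u))
    <= spread_const alpha A B * (x `^ alpha / Num.sqrt x).
Proof.
move=> al0 x1 xa hA hB.
have x0 : 0 < x by apply: lt_le_trans x1.
have X0 : 0 < x `^ alpha by rewrite powR_gt0.
have q0 : 0 < Num.sqrt x by rewrite sqrtr_gt0.
have q1 : 1 <= Num.sqrt x by rewrite -[leLHS]sqrtr1 ler_wsqrtr.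
have qx : Num.sqrt x ^+ 2 = x by rewrite sqr_sqrtr// ltW.
have pi0 := pi_gt0 R.
have A0 : 0 <= A.
  by rewrite -(pmulr_lge0 _ q0) (le_trans _ hA)// subr_ge0.
have hrad := @powR_incr_le alpha x a (A / Num.sqrt x) al0 x0 xa.
have {}hrad : a `^ alpha - x `^ alpha
   <= x `^ alpha * (alpha * (A / Num.sqrt x) * expR (alpha * (A / Num.sqrt x))).
  by apply: hrad; rewrite -[X in _ / _ * X]qx expr2 mulrA divfK// gt_eqF.
have XA : x `^ alpha <= a `^ alpha.
  by rewrite ge0_ler_powR ?nnegrE ?(ltW al0) ?(ltW x0)// (le_trans (ltW x0)).
set X := x `^ alpha in X0 hrad XA *; set q := Num.sqrt x in q0 q1 qx hA hB hrad *.
rewrite -opprB (normcN (_ - _)).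
apply: le_trans (cabs_polarB_le u t (- k) (powR_ge0 a alpha) (ltW X0)) _.
rewrite ger0_norm ?subr_ge0//.
have -> : `|u - t - (- k)%:~R| = `|t - u - k%:~R|.
  by rewrite -normrN mulrNz; congr `|_|; ring.
have -> : spread_const alpha A B * (X / q)
  = X * (alpha * (A / q) * expR (alpha * A)) + X * (2 * pi * (B / q)).
  by rewrite /spread_const; field; rewrite gt_eqF.
apply: lerD.
  apply: le_trans hrad _; rewrite ler_pM2l// ler_wpM2l//.
    by rewrite mulr_ge0 ?divr_ge0 ?(ltW al0) ?(ltW q0).
  by rewrite ler_expR ler_wpM2l ?(ltW al0)// ler_pdivrMr// ler_peMr.
by rewrite ler_pM2l// ler_pM2l// mulr_gt0.
Qed.

End Scale.

(** * Convergents and bounded partial quotients *)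

Section Diophantine.
Context {R : realType}.
Implicit Types (theta x : R).

Definition diophantine theta : Prop :=
  exists2 c : R, 0 < c & forall (m : nat) (p : int), (0 < m)%N ->
    c <= m%:R * `|m%:R * theta - p%:~R|.

(** Coprimality is given as a Bezout relation, from which the inverse of [p]
    modulo [q] is read off. *)
Definition reduced_fraction_near theta (p q : int) : Prop :=
  [/\ 0 < q, exists u v : int, p * u - q * v = 1
    & `|q%:~R * theta - p%:~R| <= (q%:~R)^-1].

(** Dirichlet's theorem gives [q <= Q]; the lower bound [Q <= q] is what
    bounded partial quotients add to it. *)
Definition approximable_at_every_scale theta : Prop :=
  exists C : nat, forall Q : nat, (0 < Q)%N ->
    exists p q : int, reduced_fraction_near theta p q /\ Q%:Z <= q <= C%:Z * Q%:Z.

(** [p / q] and [p' / q'] are the last two convergents before the complete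
    quotient of index [n].  The bound [n <= q + q'] records, in the weakest form
    preserved by the recursion, that the denominators tend to infinity; the
    determinant is squared because its sign alternates. *)
Definition convergent theta n (p q p' q' : int) : Prop :=
  [/\ 0 < q, 0 <= q' <= q, n%:Z <= q + q', (p * q' - p' * q) ^+ 2 = 1 &
    theta * (q%:~R * complete_quotient theta n + q'%:~R)
    = p%:~R * complete_quotient theta n + p'%:~R].

Section Irrational.
Variable theta : R.
Hypothesis irr : irrational theta.
Local Notation x := (complete_quotient theta).
Local Notation a := (partial_quotient theta).

Lemma complete_quotient_irrational n : irrational (x n).
Proof.
elim: n => [//|n IH] [r _ rE]; apply: IH; exists ((a n)%:~R + r^-1) => //.
by rewrite rmorphD/= fmorphV/= rE /= ratr_int invrK addrC subrK.
Qed.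

Lemma partial_quotient_lt n : (a n)%:~R < x n.
Proof.
rewrite lt_neqAle floor_le andbT; apply/eqP => aE.
by apply: (@complete_quotient_irrational n); exists (a n)%:~R => //;
  rewrite ratr_int.
Qed.

Lemma complete_quotientE n : x n = (a n)%:~R + (x n.+1)^-1.
Proof. by rewrite /= invrK addrC subrK. Qed.

Lemma complete_quotient_gt1 n : 1 < x n.+1.
Proof.
have h := partial_quotient_lt n.
have := floorD1_gt (x n); rewrite -/(a n) intrD /= -/(a n) => h2.
by rewrite invf_gt1 ?subr_gt0//; rewrite ltrBlDr addrC.
Qed.

Lemma partial_quotient_gt0 n : 0 < a n.+1.
Proof. by rewrite floor_gt0 ltW// complete_quotient_gt1. Qed.

Lemma convergent1 : convergent theta 1 (a 0) 1 1 0.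
Proof.
split=> //; first by rewrite mulr0 mul1r sub0r sqrrN expr1n.
have x0 := lt_trans ltr01 (complete_quotient_gt1 0).
have thE : theta = (a 0)%:~R + (x 1)^-1 := complete_quotientE 0.
move: x0 thE; set y := x 1; set A := (a 0)%:~R => y0 ->.
by rewrite mul1r addr0 mulrDl mulVf ?gt_eqF.
Qed.

Lemma convergentS n p q p' q' : convergent theta n.+1 p q p' q' ->
  convergent theta n.+2 (p * a n.+1 + p') (q * a n.+1 + q') p q.
Proof.
move=> [q0 /andP[q'0 q'q] nq det thE].
have a0 := partial_quotient_gt0 n.
split; [nia|nia|nia| |].
  by rewrite -det; ring.
have x0 := lt_trans ltr01 (complete_quotient_gt1 n.+1).
move: thE; rewrite (complete_quotientE n.+1) => thE.
move: x0 thE; set y := x n.+2; set A := (a n.+1)%:~R => y0 thE.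
rewrite !rmorphD !rmorphM -/A.
transitivity (theta * (q%:~R * (A + y^-1) + q'%:~R) * y).
  by field; rewrite gt_eqF.
by rewrite thE; field; rewrite gt_eqF.
Qed.

Lemma convergent_exists n : exists p q p' q', convergent theta n.+1 p q p' q'.
Proof.
elim: n => [|n [p [q [p' [q' /convergentS h]]]]].
  by exists (a 0), 1, 1, 0; exact: convergent1.
by do 4 eexists; exact: h.
Qed.

(** Multiplying [q * theta - p] by the denominator [q * x + q'] of the Moebius
    transformation leaves the determinant, so that the error is exactly
    [1 / (q * x + q')]. *)
Lemma convergent_error n p q p' q' : convergent theta n.+1 p q p' q' ->
  q%:~R * `|q%:~R * theta - p%:~R| <= (x n.+1)^-1.
Proof.
move=> [q0 /andP[q'0 q'q] nq det thE].
have x1 := complete_quotient_gt1 n.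
have x0 := lt_trans ltr01 x1.
set y := x n.+1 in x1 x0 thE *.
have qR : 0 < q%:~R :> R by rewrite ltr0z.
have q'R : 0 <= q'%:~R :> R by rewrite ler0z.
have e : (q%:~R * theta - p%:~R) * (q%:~R * y + q'%:~R)
    = (q * p' - p * q')%:~R.
  rewrite mulrBl -mulrA thE rmorphB /= !rmorphM /=; ring.
have {}e : `|q%:~R * theta - p%:~R| * (q%:~R * y + q'%:~R) = 1.
  rewrite -[q%:~R * y + _]ger0_norm ?addr_ge0 ?mulr_ge0 ?(ltW qR) ?(ltW x0)//.
  rewrite -normrM e.
  rewrite -intr_norm; have -> : `|q * p' - p * q'| = 1 by nia.
  by [].
rewrite -[leRHS]mul1r ler_pdivlMr// -[leRHS]e mulrAC [leLHS]mulrC.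
by rewrite ler_wpM2l// lerDl.
Qed.

Lemma convergent_near n p q p' q' : convergent theta n.+1 p q p' q' ->
  reduced_fraction_near theta p q.
Proof.
move=> cv; have err := convergent_error cv; case: cv => q0 _ _ det _.
split=> //.
  exists (q' * (p * q' - p' * q)), (p' * (p * q' - p' * q)).
  by rewrite -[RHS]det; ring.
have qR : 0 < q%:~R :> R by rewrite ltr0z.
rewrite -[leRHS]mul1r ler_pdivlMr// mulrC (le_trans err)//.
by rewrite invf_le1 ?(lt_trans ltr01) ?ltW// complete_quotient_gt1.
Qed.

End Irrational.

(** A large complete quotient makes the preceding convergent too good: by
    [convergent_error], [c <= q * `|q * theta - p| <= x^-1]. *)
Lemma diophantine_badly_approximable theta :
  diophantine theta -> badly_approximable theta.
Proof.
move=> [c c0 hc].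
have irr : irrational theta.
  move=> /rationalP[a [b thE]].
  have [b0|b0] := posnP b.
    by have := hc 1%N 0 isT; rewrite thE b0 invr0 !mulr0 subr0 normr0 mulr0
      leNgt c0.
  have := hc b a b0.
  by rewrite thE [b%:R * (_ / _)]mulrC divfK ?pnatr_eq0 -?lt0n// subrr normr0
    mulr0 leNgt c0.
split=> //.
exists (`|partial_quotient theta 0| + `|Num.floor c^-1|) => -[|n].
  by rewrite lerDl normr_ge0.
apply: le_trans (_ : `|Num.floor c^-1| <= _); last by rewrite lerDr normr_ge0.
have [p [q [p' [q' cv]]]] := convergent_exists irr n.
have := convergent_error irr cv.
case: cv => q0 _ _ _ _ err.
have := hc `|q|%N p; rewrite absz_gt0 gt_eqF// => /(_ isT).
have -> : `|q|%N%:R = q%:~R :> R by rewrite -{2}(gtz0_abs q0).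
move=> /le_trans /(_ err) cx.
have x0 : 0 < complete_quotient theta n.+1.
  by apply: lt_trans (complete_quotient_gt1 irr n).
have {}cx : complete_quotient theta n.+1 <= c^-1.
  move: x0 cx; move: (complete_quotient _ _) => y y0 cy.
  by rewrite -[y]invrK lef_pV2 ?posrE ?invr_gt0.
have := partial_quotient_gt0 irr n => a0.
rewrite gtr0_norm// (le_trans _ (ler_norm _))//.
exact: le_floor.
Qed.

(** The denominators start at [1], are unbounded, and each is at most [B + 1]
    times the preceding one; hence the first that reaches [Q] is at most
    [(B + 1) * Q]. *)
Lemma badly_approximable_scale theta :
  badly_approximable theta -> approximable_at_every_scale theta.
Proof.
move=> [irr [B hB]]; exists (`|B|%N + 1)%N => Q Q0.
(* Up to any index, either the sought convergent has been met or all
   denominators so far are smaller than [Q]. *)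
have step n : (exists p q : int, reduced_fraction_near theta p q /\
     Q%:Z <= q <= (`|B|%N + 1)%N%:Z * Q%:Z) \/
   (exists p q p' q', convergent theta n.+1 p q p' q' /\ q < Q%:Z).
  elim: n => [|n [|[p [q [p' [q' [cv qQ]]]]]]].
  - have cv := convergent1 irr.
    have [Q1|Q1] := ltP 1%:Z Q%:Z.
      by right; do 4 eexists; split; [exact: cv|].
    left; do 2 eexists; split; first exact: convergent_near cv.
    by nia.
  - by left.
  - have cv' := convergentS irr cv.
    have [qQ'|qQ'] := ltP (q * partial_quotient theta n.+1 + q') Q%:Z.
      by right; do 4 eexists; split; [exact: cv'|].
    left; do 2 eexists; split; first exact: convergent_near cv'.
    rewrite qQ'/=.
    case: cv => q0 /andP[q'0 q'q] _ _ _.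
    have := hB n.+1; have := partial_quotient_gt0 irr n.
    set a := partial_quotient _ _; move=> a0 aB; nia.
have [//|[p [q [p' [q' [[q0 /andP[q'0 q'q] nq _ _] qQ]]]]]] := step (2 * Q)%N.
by exfalso; lia.
Qed.

(** A reduced [p / q] with [2 * m <= q] differs from [k / m], hence
    [1 <= `|m * p - k * q| <= m * `|q * theta - p| + q * `|m * theta - k|].  The
    first term is at most [m / q <= 1 / 2], so the second is at least [1 / 2]. *)
Lemma scale_diophantine theta :
  approximable_at_every_scale theta -> diophantine theta.
Proof.
move=> [C hC].
have C0 : (0 < C)%N.
  by have [p [q [[q0 _ _]]]] := hC 1%N isT; lia.
exists (4 * C%:R)^-1; first by rewrite invr_gt0 mulr_gt0// ltr0n.
move=> m k m0; have [|p [q [[q0 [u [v uv]] err] qC]]] := hC (2 * m)%N.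
  by rewrite muln_gt0.
have qR : 0 < q%:~R :> R by rewrite ltr0z.
have mR : 0 < m%:R :> R by rewrite ltr0n.
have CR : 0 < C%:R :> R by rewrite ltr0n.
(* Otherwise [q], being coprime to [p], divides [m], which is smaller. *)
have nz : m%:Z * p - k * q != 0.
  apply/eqP => e.
  have : m%:Z = q * (k * u - m%:Z * v).
    have -> : q * (k * u - m%:Z * v) = (k * q) * u - m%:Z * (q * v) by ring.
    have -> : k * q = m%:Z * p by lia.
    by rewrite -[LHS]mulr1 -uv; ring.
  set w := _ - _ => mE.
  have w0 : 0 < w by nia.
  nia.
have h1 : 1 <= `|m%:R * p%:~R - k%:~R * q%:~R| :> R.
  have : 1 <= `|m%:Z * p - k * q| by lia.
  by rewrite -(ler_int R) intr_norm rmorphB /= !rmorphM /=.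
have h2 : `|m%:R * p%:~R - k%:~R * q%:~R|
   <= m%:R * `|q%:~R * theta - p%:~R| + q%:~R * `|m%:R * theta - k%:~R| :> R.
  have -> : m%:R * p%:~R - k%:~R * q%:~R
    = q%:~R * (m%:R * theta - k%:~R) - m%:R * (q%:~R * theta - p%:~R) :> R by ring.
  apply: le_trans (ler_normB _ _) _.
  by rewrite !normrM (gtr0_norm mR) (gtr0_norm qR) addrC.
have q2 : 2 * m%:R <= q%:~R :> R.
  case/andP: qC => + _; rewrite -(ler_int R) PoszM rmorphM //=.
have q3 : q%:~R <= 2 * C%:R * m%:R :> R.
  case/andP: qC => _; rewrite -(ler_int R) !PoszM !rmorphM /=.
  by rewrite mulrCA mulrA.
have h3 : m%:R * `|q%:~R * theta - p%:~R| <= 1 / 2.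
  apply: le_trans (_ : m%:R * (q%:~R)^-1 <= _).
    by rewrite ler_wpM2l// ltW.
  by rewrite ler_pdivrMr//; lra.
have h4 : 1 / 2 <= q%:~R * `|m%:R * theta - k%:~R| by lra.
have h5 := ler_wpM2r (normr_ge0 (m%:R * theta - k%:~R)) q3.
rewrite -[leLHS]mul1r ler_pdivrMr ?mulr_gt0//.
by lra.
Qed.

End Diophantine.

(** * The spiral *)

Lemma card_le_I1P (T : Type) (A : set T) : (A #<= `I_1)%card <-> is_subset1 A.
Proof.
split=> [/pcard_leP[f] x y Ax Ay|A1].
  have fI z : A z -> f z = 0%N.
    by move=> Az; have /= := @funS _ _ _ _ f z Az; rewrite ltnS leqn0 => /eqP.
  by apply: (@inj _ _ A f); rewrite ?inE//= (fI x Ax) (fI y Ay).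
have [->|/set0P[x Ax]] := eqVneq A set0; first exact: card_ge0.
rewrite -(card_le_eqr (@card_set1 _ x)).
by apply: subset_card_le => y Ay; exact: A1.
Qed.

Lemma nat_above (R : realType) (x : R) : exists2 l : nat, (0 < l)%N & x <= l%:R.
Proof.
exists (Num.truncn `|x|).+1 => //.
have /andP[_ /ltW] := truncn_itv (normr_ge0 x).
exact: le_trans (ler_norm x).
Qed.

Section Spiral.
Context {R : realType}.
Variables alpha theta beta : R.
Hypothesis al0 : 0 < alpha.
Hypothesis hab : 1 + 2 * alpha * beta = 2 * alpha.
Local Notation Gamma := (spiral_set alpha theta).
Local Notation K := (gap_const alpha).

Definition spiral_point (n : nat) : R[i] :=
  polar (n%:R `^ alpha) (2 * pi * (n%:R * theta)).

Lemma spiral_setP z : Gamma z <-> exists n, z = spiral_point n.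
Proof.
split=> [[n _ <-]|[n ->]]; exists n => //; by rewrite /spiral_point mulrA.
Qed.

Lemma cabs_spiral_point n : cabs (spiral_point n) = n%:R `^ alpha.
Proof. by rewrite cabs_polar// powR_ge0. Qed.

Lemma powR_root_le (M x : R) : 0 <= M -> M `^ alpha^-1 <= x -> M <= x `^ alpha.
Proof.
move=> M0 Mx.
have {1}-> : M = (M `^ alpha^-1) `^ alpha.
  by rewrite -powRrM mulVf ?gt_eqF// powRr1.
by rewrite ge0_ler_powR ?nnegrE ?(ltW al0) ?powR_ge0// (le_trans _ Mx) ?powR_ge0.
Qed.

Lemma outside_spiralP z : outside_unit_disc Gamma z <->
  exists2 n, (0 < n)%N & z = spiral_point n.
Proof.
split=> [[/spiral_setP[n ->]]|[n n0 ->]].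
  rewrite cabs_spiral_point; case: n => [|n] h; last by exists n.+1.
  by move: h; rewrite powR0 ?gt_eqF// ler10.
split; first by apply/spiral_setP; exists n.
by rewrite cabs_spiral_point powR_root_le// powR1 ler1n.
Qed.

(** Every point away from the unit disc is a point of the spiral with a real
    index [x] and an arbitrary phase [t]. *)
Lemma chart (z : R[i]) : 1 <= cabs z -> exists x t : R,
  [/\ 1 <= x, z = polar (x `^ alpha) (2 * pi * t) & cabs z = x `^ alpha].
Proof.
move=> z1; have [t zE] := polarP z.
have zx : cabs z = (cabs z `^ alpha^-1) `^ alpha.
  by rewrite -powRrM mulVf ?gt_eqF// powRr1// cabs_ge0.
exists (cabs z `^ alpha^-1), (t / (2 * pi)); split=> //.
  have {1}-> : 1 = 1 `^ alpha^-1 :> R by rewrite powR1.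
  by rewrite ge0_ler_powR ?nnegrE ?cabs_ge0// invr_ge0 ltW.
rewrite -zx [2 * pi * _]mulrC divfK//.
by rewrite mulf_neq0 ?pnatr_eq0// gt_eqF// pi_gt0.
Qed.

Lemma spiral_locally_finite : locally_finite_set Gamma.
Proof.
move=> r r0; have [l _ hl] := nat_above (r `^ alpha^-1).
apply: (@sub_finite_set _ _ (spiral_point @` `I_l)%classic); last first.
  exact: finite_image.
move=> _ [/spiral_setP[n ->]]; rewrite cabs_spiral_point => nr; exists n => //=.
rewrite ltnNge; apply/negP => ln; move: nr; rewrite ltNge powR_root_le ?(ltW r0)//.
by rewrite (le_trans hl)// ler_nat.
Qed.

(** Square indices [N = (l * m) ^ 2] make the window width [sqrt N = l * m] an
    integer multiple of [m]; a large [l], chosen once for all [m], brings the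
    point beyond any prescribed radius [M]. *)
Lemma square_index (M : R) (l m : nat) : 0 <= M -> (0 < l)%N -> (0 < m)%N ->
  M `^ alpha^-1 <= l%:R ->
  let N := ((l * m) ^ 2)%N%:R : R in
  [/\ 1 <= N, Num.sqrt N = l%:R * m%:R & M <= N `^ alpha].
Proof.
move=> M0 l0 m0 hl; split.
- by rewrite ler1n expn_gt0 muln_gt0 l0 m0.
- by rewrite natrX natrM sqrtr_sqr ger0_norm.
- apply: powR_root_le => //; apply: le_trans hl _.
  rewrite ler_nat (leq_trans (leq_pmulr l m0))//.
  by rewrite -mulnn leq_pmulr// muln_gt0 l0.
Qed.

(** If [m * theta] is very close to an integer, the points of indices [N] and
    [N + m] lie in one small ball once [sqrt N] is a large multiple of [m]. *)
Lemma uniformly_discrete_diophantine :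
  asymp_uniformly_discrete beta Gamma -> diophantine theta.
Proof.
move=> [_ [s s0 hs]].
have [||M M0 hM] := hs (s / 2); [lra..|].
have pi0 := pi_gt0 R.
have e0 := expR_gt0 alpha.
have [l l0 hl] := nat_above (M `^ alpha^-1 + 8 * alpha * expR alpha / s).
have lR : 0 < l%:R :> R by rewrite ltr0n.
have l1 : 1 <= l%:R :> R by rewrite ler1n.
have hl1 : M `^ alpha^-1 <= l%:R.
  by apply: le_trans hl; rewrite lerDl divr_ge0 ?(ltW s0)// !mulr_ge0 ?ltW.
have hl2 : 8 * alpha * expR alpha / s <= l%:R.
  by apply: le_trans hl; rewrite lerDr powR_ge0.
(* With [1 / l] and [s / (16 * pi)] as displacements, index and phase contribute
   at most [s / 8] each to the distance, whose bound is [s / 2]. *)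
set c := s / (16 * pi * l%:R).
exists c; first by rewrite divr_gt0// !mulr_gt0.
move=> m p m0; rewrite leNgt; apply/negP => hc.
have mR : 0 < m%:R :> R by rewrite ltr0n.
have m1 : 1 <= m%:R :> R by rewrite ler1n.
set N := ((l * m) ^ 2)%N.
have [N1 sN hMN] := square_index (ltW M0) l0 m0 hl1.
rewrite -/N in N1 sN hMN.
have lm0 : 0 < l%:R * m%:R :> R by rewrite mulr_gt0.
have N0 : 0 < N%:R :> R by apply: lt_le_trans N1.
have := hM (spiral_point N); rewrite cabs_spiral_point => /(_ hMN).
rewrite (powR_scale hab N0) => /card_le_I1P ball1.
have X0 : 0 < N%:R `^ alpha / Num.sqrt N%:R :> R.
  by rewrite divr_gt0 ?powR_gt0 ?sqrtr_gt0.
have : spiral_point N = spiral_point (N + m).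
  apply: ball1.
- split; first by apply/outside_spiralP; exists N => //; rewrite -(ltr0n R).
  by rewrite subrr ComplexField.Normc.normc0 mulr_gt0// divr_gt0.
- split.
    by apply/outside_spiralP; exists (N + m)%N => //; rewrite addn_gt0 m0 orbT.
  have h := @coords_close_polar R alpha (N + m)%:R N%:R l%:R^-1 (s / (16 * pi))
     (N%:R * theta) ((N + m)%:R * theta) (- p) al0 N1.
  apply: le_lt_trans (h _ _ _) _.
  + by rewrite ler_nat leq_addr.
  + by rewrite natrD addrC addKr sN mulrA mulVf ?mul1r// gt_eqF.
  + have -> : N%:R * theta - (N + m)%:R * theta - (- p)%:~R
      = - (m%:R * theta - p%:~R) by rewrite natrD mulrNz; ring.
    rewrite normrN sN; apply: ltW.
    rewrite ltr_pdivlMr// mulrCA mulrC [_ * m%:R]mulrC.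
    have -> : s / (16 * pi) = c * l%:R.
      rewrite /c; move: pi0; move: (@pi R) => P P0; field.
      by rewrite !gt_eqF.
    by rewrite ltr_pM2r.
  + rewrite ltr_pM2r//.
    have -> : spread_const alpha l%:R^-1 (s / (16 * pi))
      = alpha / l%:R * expR (alpha / l%:R) + s / 8.
      rewrite /spread_const; move: pi0; move: (@pi R) => P P0; field.
      by rewrite !gt_eqF.
    have h1 : expR (alpha / l%:R) <= expR alpha.
      by rewrite ler_expR ler_pdivrMr// ler_peMr// ltW.
    have h2 : alpha / l%:R * expR (alpha / l%:R) <= alpha / l%:R * expR alpha.
      by rewrite ler_wpM2l// divr_ge0 ?ltW.
    have h3 : alpha / l%:R * expR alpha <= s / 8.
      by rewrite mulrAC ler_pdivrMr//; move: hl2; rewrite ler_pdivrMr//; lra.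
    lra.
- move=> /(congr1 (@ComplexField.Normc.normc R)).
  rewrite !cabs_spiral_point => /eqP; apply/negP.
  rewrite lt_eqF// gt0_ltr_powR ?nnegrE ?ler0n//.
  by rewrite ltr_nat -[ltnLHS]addn0 ltn_add2l.
Qed.

(** Two points in a ball of radius [s] in units of the scale have indices
    differing by some [m <= 4 * K * s * sqrt x], and phases differing by at most
    [4 * s / sqrt x] modulo [1].  The product of these bounds is
    [16 * K * s ^+ 2], which is less than [c] for small [s]. *)
Lemma diophantine_uniformly_discrete :
  diophantine theta -> asymp_uniformly_discrete beta Gamma.
Proof.
move=> [c c0 hc]; split; first exact: spiral_locally_finite.
have K0 := gap_const_gt0 al0.
exists (Num.min (1 / 2) (c / (16 * K))).
  by rewrite lt_min !divr_gt0// mulr_gt0.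
move=> s s0; rewrite lt_min => /andP[s_half s_small].
exists 1 => // z z1; apply/card_le_I1P.
have [x [t [x1 zE ->]]] := chart z1.
have x0 : 0 < x by apply: lt_le_trans x1.
have q1 : 1 <= Num.sqrt x by rewrite -[leLHS]sqrtr1 ler_wsqrtr.
have q0 : 0 < Num.sqrt x by rewrite sqrtr_gt0.
rewrite (powR_scale hab x0) => _ _ /= [/outside_spiralP[a a0 ->] ha]
  [/outside_spiralP[b b0 ->] hb].
congr spiral_point; move: a b a0 b0 ha hb.
have main a b : (0 < a)%N -> (a < b)%N ->
  cabs (z - spiral_point a) < s * (x `^ alpha / Num.sqrt x) ->
  cabs (z - spiral_point b) < s * (x `^ alpha / Num.sqrt x) -> False.
  move=> a0 ab; have b0 := leq_ltn_trans (leq0n _) ab.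
  rewrite zE => /ltW ha /ltW hb.
  have sx : s <= Num.sqrt x / 2 by lra.
  have [|ra [k hk]] := polar_close_coords al0 _ x0 sx ha; first by rewrite ltr0n.
  have [|rb [k' hk']] := polar_close_coords al0 _ x0 sx hb; first by rewrite ltr0n.
  have := hc (b - a)%N (k - k'); rewrite subn_gt0 => /(_ ab).
  rewrite natrB ?(ltnW ab)//.
  have d1 : b%:R - a%:R <= 4 * K * s * Num.sqrt x.
    move: ra rb; rewrite !ler_norml => /andP[? ?] /andP[? ?]; lra.
  have d2 : `|(b%:R - a%:R) * theta - (k - k')%:~R| <= 4 * s / Num.sqrt x.
    have -> : (b%:R - a%:R) * theta - (k - k')%:~R
      = (t - a%:R * theta - k%:~R) - (t - b%:R * theta - k'%:~R).
      by rewrite rmorphB /=; ring.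
    apply: le_trans (ler_normB _ _) _; lra.
  have d0 : 0 <= b%:R - a%:R :> R by rewrite subr_ge0 ler_nat ltnW.
  have := ler_pM d0 (normr_ge0 _) d1 d2.
  have -> : 4 * K * s * Num.sqrt x * (4 * s / Num.sqrt x) = 16 * K * (s * s).
    by field; rewrite gt_eqF.
  move=> /[swap] /le_trans /[apply].
  have K16 : 0 < 16 * K by rewrite mulr_gt0.
  move: s_small; rewrite ltr_pdivlMr// => s_small.
  nra.
by move=> a b a0 b0 ha hb; case: (ltngtP a b) => // h; exfalso;
  [exact: (main a b)|exact: (main b a)].
Qed.

(** If [m * theta] is very close to an integer, the phases of the points whose
    index is within [O(sqrt N)] of [N] stay near the translates of [N * theta]
    by multiples of [1 / m]; the phase halfway between two consecutive
    translates is then far from all of them. *)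
Lemma relatively_dense_diophantine :
  asymp_relatively_dense beta Gamma -> diophantine theta.
Proof.
move=> [r r0 hr]; have [|M M0 hM] := hr (r + 1); first by lra.
have K0 := gap_const_gt0 al0.
have {r r0 hr hM} [r r0 hM] : exists2 r, 0 < r & forall z : R[i],
  M <= cabs z -> exists2 zeta : R[i], outside_unit_disc Gamma zeta &
  cabs (z - zeta) < r * cabs z `^ beta by exists (r + 1); [lra|exact: hM].
have [l l0 hl] := nat_above (M `^ alpha^-1 + 8 * r).
have lR : 0 < l%:R :> R by rewrite ltr0n.
have l1 : 1 <= l%:R :> R by rewrite ler1n.
have hl1 : M `^ alpha^-1 <= l%:R.
  by apply: le_trans hl; rewrite lerDl; lra.
have hl2 : 8 * r <= l%:R.
  by apply: le_trans hl; rewrite lerDr powR_ge0.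
have c0 : 0 < 8 * K * r * l%:R by rewrite mulr_gt0// mulr_gt0// mulr_gt0.
exists (8 * K * r * l%:R)^-1; first by rewrite invr_gt0.
move=> m p m0.
have mR : 0 < m%:R :> R by rewrite ltr0n.
have m1 : 1 <= m%:R :> R by rewrite ler1n.
set N := ((l * m) ^ 2)%N.
have [N1 sN hMN] := square_index (ltW M0) l0 m0 hl1.
rewrite -/N in N1 sN hMN.
have lm0 : 0 < l%:R * m%:R :> R by rewrite mulr_gt0.
have N0 : 0 < N%:R :> R by apply: lt_le_trans N1.
set t := N%:R * theta + (2 * m%:R)^-1.
have := hM (polar (N%:R `^ alpha) (2 * pi * t)).
rewrite cabs_polar ?powR_ge0// (powR_scale hab N0) => /(_ hMN).
move=> [_ /outside_spiralP[n n0 ->] /ltW hn].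
have [||hrad [k hk]] := polar_close_coords al0 _ N0 _ hn; first by rewrite ltr0n.
  by rewrite sN; nra.
move: hrad hk; rewrite sN => hrad hk.
(* [m * (t - n * theta - k)] is [1 / 2] minus an integer, up to the error
   [(n - N) * (m * theta - p)]; it is at most [1 / 4] in absolute value, so the
   error is at least [1 / 4]. *)
set eps := `|m%:R * theta - p%:~R|.
have eE : m%:R * (t - n%:R * theta - k%:~R)
  = 1 / 2 - (p * (n%:Z - N%:Z) + m%:Z * k)%:~R
    - (n%:R - N%:R) * (m%:R * theta - p%:~R).
  by rewrite /t !rmorphD !rmorphM rmorphB /=; field; rewrite gt_eqF.
have h1 : `|m%:R * (t - n%:R * theta - k%:~R)| <= 1 / 4.
  rewrite normrM gtr0_norm//.
  apply: le_trans (ler_wpM2l (ltW mR) hk) _.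
  have -> : m%:R * (2 * r / (l%:R * m%:R)) = 2 * r / l%:R.
    by field; rewrite !gt_eqF.
  by rewrite ler_pdivrMr//; lra.
have h2 : `|(n%:R - N%:R) * (m%:R * theta - p%:~R)|
  <= 2 * K * r * (l%:R * m%:R) * eps.
  by rewrite normrM ler_wpM2r.
have h3 (w : int) : 1 / 2 <= `|1 / 2 - w%:~R| :> R.
  have [w0|w0] := leP w 0.
    have : w%:~R <= 0 :> R by rewrite lerz0.
    by rewrite ler_normr; lra.
  have : 1 <= w%:~R :> R by rewrite ler1z.
  by rewrite ler_normr; lra.
have h4 := h3 (p * (n%:Z - N%:Z) + m%:Z * k).
have h5 := ler_normD (m%:R * (t - n%:R * theta - k%:~R))
   ((n%:R - N%:R) * (m%:R * theta - p%:~R)).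
rewrite {1}eE subrK in h5.
by rewrite -[leLHS]mul1r ler_pdivrMr//; lra.
Qed.

(** Let [p / q] be a reduced fraction close to [theta] with [q] of order
    [sqrt x].  Over [q] consecutive indices [j * theta] follows [j * p / q], which
    runs through all multiples of [1 / q] modulo [1]; so some index in the window
    has a phase within [2 / q] of the target [t]. *)
Lemma scale_relatively_dense :
  approximable_at_every_scale theta -> asymp_relatively_dense beta Gamma.
Proof.
move=> [C hC].
have pi0 := pi_gt0 R.
exists (spread_const alpha (1 + C%:R) 4).
  have C0 : 0 < 1 + C%:R :> R by rewrite ltr_wpDr.
  by rewrite addr_gt0 ?mulr_gt0 ?expR_gt0.
move=> r hr; exists 1 => // z z1.
have [x [t [x1 -> ->]]] := chart z1.
have x0 : 0 < x by apply: lt_le_trans x1.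
rewrite (powR_scale hab x0).
have q1 : 1 <= Num.sqrt x by rewrite -[leLHS]sqrtr1 ler_wsqrtr.
have q0 : 0 < Num.sqrt x by rewrite sqrtr_gt0.
set sx := Num.sqrt x in q1 q0 *.
have /andP[N1 N2] := truncn_itv (ltW x0); set N := Num.truncn x in N1 N2.
have /andP[Q1 Q2] := truncn_itv (ltW q0); set Q := Num.truncn sx in Q1 Q2.
have Q0 : (0 < Q)%N by rewrite truncn_gt0.
have [p [q [[q0' [u [v uv]] err] /andP[qQ qC]]]] := hC Q Q0.
have qR : 0 < q%:~R :> R by rewrite ltr0z.
(* [w / q] is the multiple of [1 / q] just below the phase to be covered,
   and [u], the inverse of [p] modulo [q], gives the offset that attains it.
   Starting at [N.+1] keeps every candidate index above [x]. *)
set w : int := Num.floor (q%:~R * (t - N.+1%:R * theta)).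
have /andP[w1 w2] := floor_itv (q%:~R * (t - N.+1%:R * theta)).
rewrite -/w intrD in w1 w2.
set j : int := ((w * u) %% q)%Z.
have q_neq0 : q != 0 by rewrite gt_eqF.
have j0 : 0 <= j by rewrite modz_ge0.
have jq : j < q by rewrite ltz_pmod.
set k : int := v * w - (w * u %/ q)%Z * p.
have jE : j * p = w + q * k.
  have -> : j = - ((w * u %/ q)%Z * q) + w * u.
    by rewrite [X in _ = _ + X](divz_eq (w * u) q) addKr.
  have puE : p * u = 1 + q * v by rewrite -uv; ring.
  rewrite /k; set d := (_ %/ _)%Z.
  have -> : (- (d * q) + w * u) * p = w * (p * u) - d * q * p by ring.
  by rewrite puE; ring.
exists (spiral_point (N.+1 + `|j|)).
  by apply/outside_spiralP; exists (N.+1 + `|j|)%N.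
have jR : `|j|%N%:R = j%:~R :> R by rewrite -{2}(gez0_abs j0).
have nE : (N.+1 + `|j|)%N%:R = N.+1%:R + j%:~R :> R by rewrite natrD jR.
apply: (@le_lt_trans _ _
  (spread_const alpha (1 + C%:R) 4 * (x `^ alpha / sx))); last first.
  by rewrite ltr_pM2r// divr_gt0// powR_gt0.
apply: (@coords_close_polar R alpha _ x _ _ t _ (- k)) => //; rewrite nE -/sx.
- rewrite (le_trans (ltW N2))// lerDl ler0z//.
- have jq1 : j%:~R + 1 <= q%:~R :> R by rewrite -(intrD R j 1) ler_int lezD1.
  have qC' : q%:~R <= C%:R * Q%:R :> R.
    by move: qC; rewrite -(ler_int R) rmorphM.
  have CQ : C%:R * Q%:R <= C%:R * sx by rewrite ler_wpM2l.
  rewrite -natr1; lra.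
- have -> : t - (N.+1%:R + j%:~R) * theta - (- k)%:~R
    = ((q%:~R * (t - N.+1%:R * theta) - w%:~R)
       - j%:~R * (q%:~R * theta - p%:~R)) / q%:~R.
    have : j%:~R * p%:~R = w%:~R + q%:~R * k%:~R :> R.
      by rewrite -!rmorphM -rmorphD -jE.
    rewrite mulrNz => e.
    have -> : k%:~R = (j%:~R * p%:~R - w%:~R) / q%:~R :> R.
      by rewrite e; field; rewrite gt_eqF.
    by field; rewrite gt_eqF.
  have jR0 : 0 <= j%:~R :> R by rewrite ler0z.
  have h1 : `|j%:~R * (q%:~R * theta - p%:~R)| <= 1.
    rewrite normrM ger0_norm//.
    apply: le_trans (ler_wpM2l jR0 err) _.
    by rewrite ler_pdivrMr// mul1r ler_int ltW.
  have h2 : `|q%:~R * (t - N.+1%:R * theta) - w%:~R| <= 1.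
    by rewrite ger0_norm ?subr_ge0//; lra.
  rewrite normrM normfV (gtr0_norm qR) ler_pdivrMr//.
  apply: (@le_trans _ _ 2); first by apply: le_trans (ler_normB _ _) _; lra.
  have qQ' : Q%:R <= q%:~R :> R by rewrite -(ler_int R) in qQ.
  have Q1R : 1 <= Q%:R :> R by rewrite ler1n.
  rewrite mulrAC ler_pdivlMr//; rewrite -natr1 in Q2; lra.
Qed.

End Spiral.

Theorem theorem4 (R : realType) (alpha theta beta : R)
  (halpha : 0 < alpha) (hbeta : beta < 1)
  (hab : 1 + 2 * alpha * beta = 2 * alpha) :
  [<-> asymp_relatively_dense beta (spiral_set alpha theta);
       asymp_uniformly_discrete beta (spiral_set alpha theta);
       badly_approximable theta].
Proof.
tfae.
- move=> /(relatively_dense_diophantine halpha hab).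
  exact: diophantine_uniformly_discrete.
- move=> /(uniformly_discrete_diophantine halpha hab).
  exact: diophantine_badly_approximable.
- move=> /badly_approximable_scale.
  exact: scale_relatively_dense.
Qed.
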